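(* Let $\alpha,\beta,\gamma>0$ with $\gamma\le\alpha\beta$, and suppose that the operator $A$ has an eigenvalue $\lambda>0$. Let $\varrho\in(\beta-\tfrac{\gamma}{\alpha},\beta)$ be arbitrarily fixed. Then, for every $\delta>0$ sufficiently large, there exist $\varepsilon>0$, an initial datum $U_0\in\mathcal{H}=H^1\times H^1\times H$ and a sequence $t_n\to\infty$ such that the energy $$\mathsf{F}(t)= \|u(t)\|_1^2 + \|\partial_t u(t)\|_1^2 + \|\partial_{tt} u(t)\|^2+ \varrho\delta\int_0^t \mathrm{e}^{-\delta(t-s)}\|\partial_t u(t)-\partial_t u(s)\|_1^2\, \mathrm{d} s$$ associated to the (unique weak) solution $U=(u,\partial_tu,\partial_{tt}u)\in\mathcal{C}([0,\infty),\mathcal{H})$ of $$\partial_{ttt} u(t) + \alpha \partial_{tt} u(t) + \beta A \partial_t u(t) + \gamma Au(t)-\varrho\delta \int_0^t \mathrm{e}^{-\delta (t-s)} A \partial_t u(s)\,\mathrm{d} s=0$$ originating from $U(0)=U_0$ satisfies $$\mathsf{F}(t_n) \geq \lambda\, \mathrm{e}^{\varepsilon t_n}\qquad\text{for all } n \in \mathbb{N}.$$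
   Context: $(H,\langle\cdot,\cdot\rangle,\|\cdot\|)$ is a separable real Hilbert space and $A:\mathfrak{D}(A)\subset H\to H$ is a strictly positive selfadjoint linear operator, bounded or unbounded (strictly positive: its spectrum is contained in $[\lambda_1,\infty)$ for some $\lambda_1>0$). For $r\in\mathbb{R}$, $H^r=\mathfrak{D}(A^{r/2})$ with $\langle u,v\rangle_r=\langle A^{r/2}u,A^{r/2}v\rangle$ and $\|u\|_r=\|A^{r/2}u\|$ (for $r<0$, $H^r$ is the completion of $H$ in this norm); the index is omitted when $r=0$. The space $\mathcal{H}=H^1\times H^1\times H$ carries the norm $\|(u,v,w)\|_{\mathcal{H}}^2=\|u\|_1^2+\|v\|_1^2+\|w\|^2$. Weak solution with initial datum $U_0$: a function $U=(u,\partial_tu,\partial_{tt}u)\in\mathcal{C}([0,\infty),\mathcal{H})$ with $U(0)=U_0$ such that for every $\varphi\in H^1$ the map $t\mapsto\langle\partial_{tt}u(t),\varphi\rangle$ is locally absolutely continuous on $[0,\infty)$ and for almost every $t\ge0$ $$\frac{\mathrm{d}}{\mathrm{d}t}\langle\partial_{tt}u(t),\varphi\rangle+\alpha\langle\partial_{tt}u(t),\varphi\rangle+\beta\langle\partial_tu(t),\varphi\rangle_1+\gamma\langle u(t),\varphi\rangle_1-\varrho\delta\int_0^t\mathrm{e}^{-\delta(t-s)}\langle\partial_tu(s),\varphi\rangle_1\,\mathrm{d}s=0.$$ For every $U_0\in\mathcal{H}$ such a solution exists and is unique, since $\varrho<\beta$. ''For every $\delta>0$ sufficiently large'' means: there is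 $\delta_0>0$ (depending on $\alpha,\beta,\gamma,\varrho,\lambda$) such that the conclusion holds for every $\delta>\delta_0$. *)

(* Defs.v *)
From HB Require Import structures.
From mathcomp Require Import all_boot all_order all_algebra.
From mathcomp Require Import all_classical all_reals all_analysis.

Set Implicit Arguments.
Unset Strict Implicit.
Unset Printing Implicit Defensive.

Import Order.TTheory GRing.Theory Num.Theory.
Import numFieldNormedType.Exports.

Local Open Scope classical_set_scope.
Local Open Scope ring_scope.

(* A real Hilbert space is a completeNormedModType R whose norm is induced by
   a positive definite symmetric bilinear form, {dot H for idfun}. *)
Definition norm_induced_by (R : realType) (H : normedModType R)
    (ip : {dot H for (@idfun R)}) : Prop :=
  forall x : H, `|x| ^+ 2 = ip x x.

Definition separable (T : topologicalType) : Prop :=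
  exists2 D : set T, countable D & dense D.

(* A possibly unbounded linear operator: opfun is a total function whose values
   outside the linear subspace dom are irrelevant. *)
Record linop (R : realType) (H : lmodType R) := Linop {
  dom : set H ;
  opfun :> H -> H ;
  dom0 : dom 0 ;
  dom_lin : forall (a : R) (x y : H), dom x -> dom y -> dom (a *: x + y) ;
  op_lin : forall (a : R) (x y : H), dom x -> dom y ->
    opfun (a *: x + y) = a *: opfun x + opfun y
}.

(* Equality with the adjoint, as graphs: the left-hand side below says that y
   is in the domain of the adjoint and that the adjoint maps y to z. *)
Definition selfadjoint (R : realType) (H : normedModType R)
    (ip : {dot H for (@idfun R)}) (A : linop H) : Prop :=
  dense (dom A) /\
  forall y z : H,
    (forall x, dom A x -> ip (A x) y = ip x z) <-> (dom A y /\ A y = z).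

Definition resolvent_set (R : realType) (H : normedModType R)
    (A : linop H) : set R :=
  [set mu | exists B : {linear H -> H},
    [/\ continuous B,
        forall y, dom A (B y) /\ A (B y) - mu *: B y = y &
        forall x, dom A x -> B (A x - mu *: x) = x]].

(* Real points only; for a selfadjoint operator this is the whole spectrum of
   the complexification. *)
Definition spectrum (R : realType) (H : normedModType R)
    (A : linop H) : set R :=
  ~` resolvent_set A.

Definition strictly_positive (R : realType) (H : normedModType R)
    (A : linop H) : Prop :=
  exists2 l1 : R, 0 < l1 & spectrum A `<=` [set mu | l1 <= mu].

Definition eigenvalue_of (R : realType) (H : lmodType R)
    (A : linop H) (l : R) : Prop :=
  exists e : H, [/\ dom A e, e != 0 & A e = l *: e].

(* S is A^(1/2), the nonnegative selfadjoint operator with S o S = A (equality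
   of domains included). By the spectral theorem a nonnegative selfadjoint A
   has exactly one such S, up to the values of opfun outside dom. *)
Definition is_sqrt_op (R : realType) (H : normedModType R)
    (ip : {dot H for (@idfun R)}) (A S : linop H) : Prop :=
  [/\ selfadjoint ip S,
      forall x, dom S x -> 0 <= ip (S x) x,
      forall x, dom A x <-> (dom S x /\ dom S (S x)) &
      forall x, dom A x -> A x = S (S x)].

(* From here on S stands for A^(1/2): H^1 is dom S, with the inner product ip1
   and the norm norm1. *)
Definition ip1 (R : realType) (H : normedModType R)
    (ip : {dot H for (@idfun R)}) (S : linop H) (x y : H) : R :=
  ip (S x) (S y).

Definition norm1 (R : realType) (H : normedModType R)
    (S : linop H) (x : H) : R :=
  `|S x|.

(* The phase space H^1 x H^1 x H and its norm. *)
Definition phase (R : realType) (H : normedModType R)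
    (S : linop H) : set (H * H * H) :=
  [set x | dom S x.1.1 /\ dom S x.1.2].

Definition phase_norm (R : realType) (H : normedModType R)
    (S : linop H) (x : H * H * H) : R :=
  Num.sqrt (norm1 S x.1.1 ^+ 2 + norm1 S x.1.2 ^+ 2 + `|x.2| ^+ 2).

Definition phase_continuous (R : realType) (H : normedModType R)
    (S : linop H) (U : R -> H * H * H) : Prop :=
  (forall t, 0 <= t -> phase S (U t)) /\
  (forall t, 0 <= t ->
     phase_norm S (U s - U t) @[s --> within `[0, +oo[ (nbhs t)] --> (0 : R)).

(* u' = v on [0, +oo[ with respect to the (semi)norm N; one-sided at 0. *)
Definition deriv_on_halfline (R : realType) (H : normedModType R)
    (N : H -> R) (u v : R -> H) : Prop :=
  forall t, 0 <= t ->
    N ((s - t)^-1 *: (u s - u t) - v t) @[s --> within `[0, +oo[ t^']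
      --> (0 : R).

Definition abs_continuous_on (R : realType) (a b : R) (f : R -> R) : Prop :=
  forall e : R, 0 < e -> exists2 d : R, 0 < d &
    forall (n : nat) (x y : 'I_n -> R),
      (forall i, a <= x i /\ x i <= y i /\ y i <= b) ->
      trivIset setT (fun i : 'I_n => `]x i, y i[%classic) ->
      \sum_(i < n) (y i - x i) < d ->
      \sum_(i < n) `|f (y i) - f (x i)| < e.

Definition loc_abs_continuous (R : realType) (f : R -> R) : Prop :=
  forall T : R, 0 <= T -> abs_continuous_on 0 T f.

(* U t = (u t, u' t, u'' t); only the values at t >= 0 matter. *)
Definition weak_solution (R : realType) (H : normedModType R)
    (ip : {dot H for (@idfun R)}) (S : linop H)
    (alpha beta gamma rho delta : R)
    (U0 : H * H * H) (U : R -> H * H * H) : Prop :=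
  let u := fun t => (U t).1.1 in
  let v := fun t => (U t).1.2 in
  let w := fun t => (U t).2 in
  [/\ phase_continuous S U,
      deriv_on_halfline (norm1 S) u v,
      deriv_on_halfline (fun x : H => `|x|) v w,
      U 0 = U0 &
      forall phi : H, dom S phi ->
        loc_abs_continuous (fun t => ip (w t) phi) /\
        {ae (@lebesgue_measure R), forall t : R, 0 <= t ->
          exists2 d : R, is_derive t 1 (fun r : R => ip (w r) phi) d &
            d + alpha * ip (w t) phi + beta * ip1 ip S (v t) phi
            + gamma * ip1 ip S (u t) phi
            - rho * delta *
              (\int[@lebesgue_measure R]_(s in `[0, t])
                 (expR (- delta * (t - s)) * ip1 ip S (v s) phi)) = 0}].

Definition energy (R : realType) (H : normedModType R) (S : linop H)
    (rho delta : R) (U : R -> H * H * H) (t : R) : R :=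
  norm1 S (U t).1.1 ^+ 2 + norm1 S (U t).1.2 ^+ 2 + `|(U t).2| ^+ 2
  + rho * delta *
    (\int[@lebesgue_measure R]_(s in `[0, t])
       (expR (- delta * (t - s)) * norm1 S ((U t).1.2 - (U s).1.2) ^+ 2)).

(* Main.v *)
(* On the line spanned by an eigenvector e of A the equation becomes a scalar
   third order equation with memory; taking eta(t) = int_0^t exp(-delta(t-s)) v(s) ds
   as a fourth unknown, an exponential exp(zt) solves it iff
   (z + delta)(z^3 + alpha z^2 + beta lambda z + gamma lambda)
   - rho delta lambda z = 0. For large delta this quartic fails the Routh-Hurwitz
   criterion, because rho > beta - gamma/alpha, and has a root p + iq with
   p, q > 0. The phase of the corresponding real solution can be chosen so that
   eta(0) = 0; it then solves the original equation, and its velocity at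
   t = 2 pi n/q is a multiple of exp(pt). For an arbitrary weak solution U with the
   same datum, pairing with e gives an absolutely continuous solution of the same
   scalar equation, hence the same function of time, and by Cauchy-Schwarz its
   velocity bounds the energy of U from below. *)

Require Import Defs.
From HB Require Import structures.
From mathcomp Require Import all_boot all_order all_algebra.
From mathcomp Require Import all_classical all_reals all_analysis.
From mathcomp Require Import measurable_realfun ring lra.
Set Implicit Arguments.
Unset Strict Implicit.
Unset Printing Implicit Defensive.
Import Order.TTheory GRing.Theory Num.Theory.
Import numFieldNormedType.Exports.

Local Open Scope classical_set_scope.
Local Open Scope ring_scope.

(** * Real quartics with a non-real root in the right half-plane *)

(** The two equations are the real and imaginary parts of z^4 + A z^3 + B z^2 + C z + D = 0 at z = p
    + i q. The condition [B * C < A * D] violates the Routh-Hurwitz inequality C^2 + A^2 D < A B C.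
    The root is that of a real quadratic factor X^2 - s X + m with s > 0 and negative
    discriminant. *)
Lemma unstable_quartic (R : rcfType) (A B C D : R) :
  0 < A -> 0 < B -> 0 < C -> 0 < D -> B * C < A * D -> C <= A * B ->
  exists p q : R, [/\ 0 < p, 0 < q,
    p ^+ 4 - 6 * p ^+ 2 * q ^+ 2 + q ^+ 4 + A * (p ^+ 3 - 3 * p * q ^+ 2)
      + B * (p ^+ 2 - q ^+ 2) + C * p + D = 0 &
    4 * p ^+ 3 * q - 4 * p * q ^+ 3 + A * (3 * p ^+ 2 * q - q ^+ 3)
      + B * (2 * p * q) + C * q = 0].
Proof.
move=> A0 B0 C0 D0 BC CAB.
pose r := Num.sqrt D.
have r0 : 0 < r by rewrite sqrtr_gt0.
have r2 : r ^+ 2 = D by rewrite sqr_sqrtr// ltW.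
(* The parameter m is sought in ]C / A, r[, where s is positive. [C <= A * B] makes this interval
   nonempty, and [B * C < A * D] makes Q positive at its left end. *)
have CAr : C < A * r.
  rewrite -(@ltr_pXn2r _ 2) ?nnegrE ?mulr_ge0 ?ltW// exprMn r2.
  rewrite -(ltr_pM2l B0) expr2 mulrA (@lt_le_trans _ _ (A * D * C)) ?ltr_pM2r//.
  rewrite -subr_ge0.
  have -> : B * (A ^+ 2 * D) - A * D * C = A * D * (A * B - C) by ring.
  by rewrite !mulr_ge0 ?subr_ge0// ltW.
(* Matching the quartic with (X^2 - s X + m)(X^2 + a X + b) and eliminating
   a, b and s leaves the single equation Q(m) = 0. *)
pose Q : {poly R} := ('X ^+ 2 - B *: 'X + D%:P) * (D%:P - 'X ^+ 2) ^+ 2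
  - A *: ('X ^+ 2 * (A *: 'X - C%:P) * (D%:P - 'X ^+ 2))
  - 'X ^+ 3 * (A *: 'X - C%:P) ^+ 2.
have QE m : Q.[m] = (m ^+ 2 - B * m + D) * (D - m ^+ 2) ^+ 2
    - A * (m ^+ 2 * (A * m - C) * (D - m ^+ 2)) - m ^+ 3 * (A * m - C) ^+ 2.
  by rewrite /Q !hornerE.
have CAr' : C / A < r by rewrite ltr_pdivrMr// mulrC.
have Qr : Q.[r] < 0.
  rewrite QE r2 subrr expr0n/= !mulr0 subr0 sub0r oppr_lt0.
  by rewrite mulr_gt0 ?exprn_gt0// subr_gt0.
have QCA : 0 < Q.[C / A].
  rewrite QE.
  have -> : A * (C / A) - C = 0 by rewrite mulrCA divff ?mulr1 ?subrr// gt_eqF.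
  rewrite !(mulr0, mul0r, expr0n)/= !subr0.
  have CA0 : 0 < C / A by rewrite divr_gt0.
  apply: mulr_gt0; last first.
    rewrite exprn_even_gt0//= -r2 subr_eq0 eqf_sqr negb_or !gt_eqF//.
    by rewrite (lt_trans _ r0)// oppr_lt0.
  have : B * (C / A) < D by rewrite mulrA ltr_pdivrMr// (mulrC D).
  have := sqr_ge0 (C / A); lra.
have [m /andP[m1 m2] Qm] : exists2 m, C / A < m < r & Q.[m] = 0.
  have [|m /andP[m1 m2]] := @poly_ivt _ (- Q) _ _ (ltW CAr').
    by rewrite !hornerN oppr_le0 oppr_ge0 !ltW.
  rewrite rootE hornerN oppr_eq0 => /eqP Qm; exists m => //.
  rewrite !lt_neqAle m1 m2 !andbT; apply/andP; split; apply/eqP => E.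
    by move: QCA; rewrite E Qm ltxx.
  by move: Qr; rewrite -E Qm ltxx.
have m0 : 0 < m by rewrite (lt_trans _ m1)// divr_gt0.
have mA : 0 < A * m - C by rewrite subr_gt0 mulrC -ltr_pdivrMr.
have mD : 0 < D - m ^+ 2.
  by rewrite subr_gt0 -r2 ltr_pXn2r// ?nnegrE ltW.
pose s := m * (A * m - C) / (D - m ^+ 2).
have s0 : 0 < s by rewrite divr_gt0// mulr_gt0.
pose a := A + s; pose b := D / m.
have EA : A = a - s by rewrite /a addrK.
have ED : D = m * b by rewrite /b mulrCA divff ?mulr1// gt_eqF.
have EC : C = m * a - s * b.
  rewrite /a /b /s; field.
  by rewrite (gt_eqF mD) (gt_eqF m0).
have EB : B = b - s * a + m.
  apply/eqP; rewrite -subr_eq0.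
  have -> : B - (b - s * a + m) = - Q.[m] / (m * (D - m ^+ 2) ^+ 2).
    rewrite QE /a /b /s; field.
    by rewrite (gt_eqF mD) (gt_eqF m0).
  by rewrite Qm oppr0 mul0r.
clearbody a b; clearbody s.
(* X^2 - s X + m has no real root: such a root would be positive. *)
have sm : 0 < m - (s / 2) ^+ 2.
  rewrite ltNge; apply/negP => sm.
  pose w := Num.sqrt ((s / 2) ^+ 2 - m).
  have w2 : w ^+ 2 = (s / 2) ^+ 2 - m by rewrite sqr_sqrtr//; lra.
  pose z := s / 2 + w.
  have z0 : 0 < z by rewrite ltr_wpDr ?sqrtr_ge0// divr_gt0.
  have zE : z ^+ 2 - s * z + m = 0.
    have -> : z ^+ 2 - s * z + m = w ^+ 2 - ((s / 2) ^+ 2 - m) by rewrite /z; field.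
    by rewrite w2 subrr.
  have : 0 < z ^+ 4 + A * z ^+ 3 + B * z ^+ 2 + C * z + D.
    by rewrite !addr_gt0// ?mulr_gt0 ?exprn_gt0.
  have -> : z ^+ 4 + A * z ^+ 3 + B * z ^+ 2 + C * z + D =
    (z ^+ 2 - s * z + m) * (z ^+ 2 + a * z + b).
    by rewrite EA EB EC ED; ring.
  by rewrite zE mul0r ltxx.
pose p := s / 2; pose q := Num.sqrt (m - p ^+ 2).
have q2 : q ^+ 2 = m - p ^+ 2 by rewrite sqr_sqrtr// ltW.
have sE : s = 2 * p by rewrite /p; field.
have mE : m = p ^+ 2 + q ^+ 2 by rewrite q2; ring.
exists p, q; split; [by rewrite divr_gt0|by rewrite sqrtr_gt0| |];
  by rewrite EA EB EC ?ED sE mE; ring.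
Qed.

(** * Absolutely continuous functions whose derivative vanishes almost everywhere *)

(** The supremum of the points where P holds is approached by such points; the step at the supremum,
    taken from one of them, reaches the supremum and, if it is below b, passes beyond it. Letting s
    and t lie on either side of x, or at x, covers both uses with one hypothesis. *)
Lemma interval_induction (R : realType) (P : R -> Prop) (a b : R) :
  a <= b -> P a ->
  (forall x, a <= x <= b -> exists2 h, 0 < h &
     forall s t, a <= s <= x -> x <= t <= b -> x - h < s -> t < x + h ->
       P s -> P t) ->
  P b.
Proof.
move=> ab Pa step.
pose S := [set x | a <= x <= b /\ P x].
have Sa : S a by split; rewrite ?lexx.
have supS : has_sup S.
  by split; [exists a|exists b => x [/andP[]]].
have aS : a <= sup S by exact: (ub_le_sup supS.2).
have Sb : sup S <= b by apply: ge_sup; [exists a|move=> x [/andP[]]].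
have [h h0 hS] := step (sup S) (introT andP (conj aS Sb)).
have [s [/andP[as_ sb] Ps] hs] := sup_adherent h0 supS.
have sS : s <= sup S by apply: (ub_le_sup supS.2); split=> //; rewrite as_.
have [Sltb|bS] := ltP (sup S) b; last first.
  apply: (hS s b) => //; rewrite ?as_ ?Sb ?lexx//.
  by rewrite (le_lt_trans bS)// ltrDl.
pose t := Num.min b (sup S + h / 2).
have St : sup S < t by rewrite lt_min Sltb ltrDl divr_gt0.
have tb : t <= b by rewrite ge_min lexx.
have Pt : P t.
  apply: (hS s t) => //; rewrite ?as_ ?tb ?(ltW St)//.
  by rewrite /t gt_min ltrD2l ltr_pdivrMr// mulr_natr mulr2n ltrDl h0 orbT.
suff : t <= sup S by rewrite leNgt St.
by apply: (ub_le_sup supS.2); split=> //; rewrite tb (le_trans aS (ltW St)).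
Qed.

(** Ordered lists of intervals, unlike families indexed by ['I_n], are easily extended by one
    interval at the right end, as the induction along [0, T] requires. *)
Lemma abs_continuous_seq (R : realType) (a b : R) (f : R -> R) :
  abs_continuous_on a b f -> forall e, 0 < e -> exists2 d, 0 < d &
  forall l : seq (R * R),
    pairwise (fun p q => p.2 <= q.1) l ->
    all (fun p => [&& a <= p.1, p.1 <= p.2 & p.2 <= b]) l ->
    \sum_(p <- l) (p.2 - p.1) < d ->
    \sum_(p <- l) `|f p.2 - f p.1| < e.
Proof.
move=> fac e e0; have [d d0 H] := fac e e0; exists d => // l.
move=> /(pairwiseP (0, 0)) pl /all_nthP al.
rewrite !(big_nth (0, 0)) !big_mkord => ld.
apply: (H _ (fun i => (nth (0, 0) l i).1) (fun i => (nth (0, 0) l i).2)) => //.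
  by move=> i; have /and3P[] := al (0, 0) i (ltn_ord i).
suff disj (i j : 'I_(size l)) : (i < j)%N ->
    ~ (`](nth (0, 0) l i).1, (nth (0, 0) l i).2[%classic `&`
       `](nth (0, 0) l j).1, (nth (0, 0) l j).2[%classic !=set0).
  move=> i j _ _ ij; apply: val_inj => /=.
  by have [/disj|/disj|//] := ltngtP i j; [|rewrite setIC].
move=> ij [x /=]; rewrite !in_itv/= => -[/andP[_ xi] /andP[jx _]].
have := lt_trans jx xi.
by rewrite ltNge (pl i j (ltn_ord i) (ltn_ord j) ij).
Qed.

Lemma is_derive1P (R : realType) (f : R -> R) (x d : R) :
  is_derive x 1 f d <->
  forall e, 0 < e -> exists2 h, 0 < h & forall s, `|s - x| < h ->
    `|f s - f x - d * (s - x)| <= e * `|s - x|.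
Proof.
split=> [[df fd] e e0|H].
  have : h^-1 *: (f (h *: 1 + x) - f x) @[h --> 0^'] --> d.
    by rewrite -fd; exact: df.
  move/cvgrPdist_le => /(_ e e0).
  rewrite near_withinE => /nbhs_ballP[h /= h0 H].
  exists h => // s sx.
  have [->|snx] := eqVneq s x; first by rewrite !subrr !normr0 !mulr0 subr0 normr0.
  have sx0 : s - x != 0 by rewrite subr_eq0.
  have := H (s - x); rewrite /ball/= sub0r normrN => /(_ sx sx0).
  rewrite /GRing.scale/= mulr1 subrK => {}H.
  rewrite -ler_pdivrMr ?normr_gt0// -normf_div -normrN.
  by congr (_ <= _): H; congr `|_|; field.
have cv : h^-1 *: (f (h *: 1 + x) - f x) @[h --> 0^'] --> d.
  apply/cvgrPdist_le => e e0; have [h h0 {}H] := H e e0.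
  rewrite near_withinE; apply/nbhs_ballP; exists h => //= s.
  rewrite /ball/= sub0r normrN => sh s0.
  have := H (s + x); rewrite addrK => /(_ sh).
  rewrite /GRing.scale/= mulr1 -ler_pdivrMr ?normr_gt0// -normf_div -normrN.
  by congr (_ <= _); congr `|_|; field.
by apply: DeriveDef; [apply/cvg_ex; exists d|exact/cvg_lim].
Qed.

Local Notation mu := (@lebesgue_measure _).

(* The exceptional null set lies in an open set U of small measure. P s bounds
   |g s - g 0| by e s, coming from the points where g' = 0, plus the increments
   of g over disjoint intervals inside U, which absolute continuity makes small. *)
Lemma abs_continuous_derive0 (R : realType) (g : R -> R) (T : R) :
  0 <= T -> abs_continuous_on 0 T g ->
  {ae (@lebesgue_measure R), forall t : R, 0 < t -> is_derive t 1 g 0} ->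
  g T = g 0.
Proof.
move=> T0 gac gae.
have key e : 0 < e -> `|g T - g 0| <= e * T + e.
  move=> e0; have [d d0 Hd] := abs_continuous_seq gac e0.
  (* The point 0 joins the exceptional set, because the derivative is only given for t > 0. *)
  have [N [mN N0 sN]] : mu.-negligible
      (~` [set t : R | 0 < t -> is_derive t 1 g 0] `|` [set 0]).
    apply: negligibleU => //.
    by apply/negligibleP => //; exact: lebesgue_measure_set1.
  have [|U [oU NU Ud]] := @lebesgue_regularity_outer R N d mN _ d0.
    exact: (eq_ind_r (fun z => z < +oo)%E (ltry 0) N0).
  have mU : measurable U by exact: open_measurable.
  have {}Ud : (mu U < d%:E)%E.
    rewrite (_ : U = N `|` (U `\` N)); last by rewrite setDUK.
    rewrite measureU//; first by rewrite [X in (X + _ < _)%E]N0 add0e.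
      exact: measurableD.
    by rewrite setDIK.
  pose P s := exists l : seq (R * R),
    [/\ pairwise (fun p q => p.2 <= q.1) l,
       all (fun p => [&& 0 <= p.1, p.1 <= p.2 & p.2 <= s]) l,
       ((\sum_(p <- l) (p.2 - p.1))%:E <= mu (U `&` `[0%R, s]))%E &
       `|g s - g 0| <= e * s + \sum_(p <- l) `|g p.2 - g p.1|].
  have [l [pl al lU gl]] : P T.
    apply: (@interval_induction _ P 0 T) => //.
      exists [::]; split => //; rewrite big_nil//.
      by rewrite subrr normr0 mulr0 addr0.
    move=> x /andP[x0 xT].
    (* Near a point of U the pair (s, t) is appended to the list: its length is paid for by the
       measure of U in ]s, t[. *)
    have [Ux|nUx] := pselect (U x).
      have /nbhs_ballP[h /= h0 hU] := open_nbhs_nbhs (conj oU Ux).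
      exists h => // s t /andP[s0 sx] /andP[xt tT] hs th [l [pl al lU gl]].
      have st := le_trans sx xt.
      have stU : `]s, t[%classic `<=` U.
        move=> y /=; rewrite in_itv/= => /andP[sy yt]; apply: hU.
        rewrite /ball/= ltr_norml; apply/andP; split; lra.
      exists (rcons l (s, t)); split.
      - rewrite pairwise_rcons pl andbT; apply: sub_all al => p.
        by move=> /and3P[].
      - rewrite all_rcons/= s0 st lexx/=; apply: sub_all al => p /and3P[-> -> ps].
        exact: le_trans ps st.
      - rewrite big_rcons/= EFinD.
        apply: (@le_trans _ _ (mu ((U `&` `[0%R, s]) `|` `]s, t[))).
          rewrite measureU//=; last 2 first.
            exact: measurableI.
            apply/seteqP; split => // y [[_]] /=.
            by rewrite !in_itv/= => /andP[_ ys] /andP[]; rewrite ltNge ys.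
          rewrite leeD//.
          rewrite [leRHS]lebesgue_measure_itv/= lte_fin.
          by case: ltP => // ts; rewrite lee_fin; lra.
        apply: le_measure; rewrite ?inE.
        + by apply: measurableU => //; exact: measurableI.
        + exact: measurableI.
        + move=> y [[Uy]|] /=; rewrite !in_itv/=.
            by move=> /andP[y0 ys]; split => //; rewrite y0 (le_trans ys).
          move=> yst; split; first by apply: stU; rewrite /= in_itv.
          move: yst => /andP[sy yt].
          by rewrite (ltW (le_lt_trans s0 sy)) ltW.
      - rewrite big_rcons/=.
        have -> : g t - g 0 = (g t - g s) + (g s - g 0) by ring.
        rewrite (le_trans (ler_normD _ _))//.
        have : e * s <= e * t by rewrite ler_pM2l.
        by move: gl; lra.
    (* Off U the derivative is 0, so the increments over [s, x] and [x, t] are at most e (x - s) and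
       e (t - x); the list is kept. *)
    have [x0' dx] : 0 < x /\ is_derive x 1 g 0.
      have nNx : ~ N x by move=> /NU.
      have x0' : 0 < x.
        rewrite lt_neqAle x0 andbT; apply/eqP => x00.
        by apply: nNx; apply: sN; right.
      split=> //; apply: contrapT => ndx; apply: nNx; apply: sN; left => /=.
      by move=> /(_ x0').
    have [h h0 H] := (is_derive1P _ _ _).1 dx e e0.
    exists h => // s t /andP[s0 sx] /andP[xt tT] hs th [l [pl al lU gl]].
    have st := le_trans sx xt.
    exists l; split => //.
    - by apply: sub_all al => p /and3P[-> -> ps]; exact: le_trans ps st.
    - apply: le_trans lU _; apply: le_measure; rewrite ?inE; [exact: measurableI..|].
      by move=> y [Uy] /=; rewrite in_itv/= => /andP[y0 ys]; split => //;
        rewrite /= in_itv/= y0 (le_trans ys).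
    - have -> : g t - g 0 = (g t - g x) - (g s - g x) + (g s - g 0) by ring.
      have gt_ : `|g t - g x| <= e * (t - x).
        have := H t; rewrite mul0r subr0 (ger0_norm (x := t - x)) ?subr_ge0//.
        by apply; lra.
      have gs_ : `|g s - g x| <= e * (x - s).
        have := H s; rewrite mul0r subr0 (distrC s x) (ger0_norm (x := x - s)) ?subr_ge0//.
        by apply; lra.
      rewrite (le_trans (ler_normD _ _))// (le_trans (lerD (ler_normB _ _) gl))//.
      by rewrite addrA lerD2r (le_trans (lerD (lerD gt_ gs_) (lexx _)))//; lra.
  apply: (le_trans gl); rewrite lerD2l ltW// Hd//.
  rewrite -lte_fin (le_lt_trans lU)// (le_lt_trans _ Ud)//.
  by apply: le_measure; rewrite ?inE//; exact: measurableI.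
apply/eqP; rewrite -subr_eq0 -normr_le0; apply/ler_addgt0Pr => e e0.
rewrite add0r (le_trans (key (e / (T + 1)) _)) ?divr_gt0 ?ltr_wpDl//.
by rewrite -[X in _ + X]mulr1 -mulrDr divfK// gt_eqF// ltr_wpDl.
Qed.

(** * Primitives, the Gronwall inequality, and the memory integral as an unknown *)

(** Integrating from -1 rather than from 0 gives the primitive a two-sided derivative at 0. *)
Lemma primitive_ge0 (R : realType) (f : R -> R) : continuous f ->
  exists G : R -> R, (forall t : R, -1 < t -> is_derive t 1 G (f t)) /\
    forall t, 0 <= t -> \int[mu]_(s in `[0, t]) f s = G t - G 0.
Proof.
move=> cf.
have cfw (a b : R) : {within `[a, b], continuous f} by exact: continuous_subspaceT.
have fi (a b : R) : mu.-integrable `[a, b] (EFin \o f).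
  by apply: continuous_compact_integrable => //; exact: segment_compact.
pose G t := \int[mu]_(s in `[-1, t]) f s.
have dG (t : R) : -1 < t -> is_derive t 1 G (f t).
  move=> t1; have tu : t < t + 1 by rewrite ltrDl.
  have [dGt Gt] := continuous_FTC1_closed tu (fi (-1) (t + 1)) t1 (cf t).
  by split; [exact: dGt|rewrite -derive1E].
exists G; split=> // t t0.
by rewrite /G Rintegral_itvB ?bnd_simp ?lerN10// Rintegral_itv_obnd_cbnd//;
  apply: integrableS (fi 0 t) => //; exact: subset_itv_oc_cc.
Qed.

(** The mean value theorem is applied to E(s) exp(-K s), whose derivative is nonpositive. *)
Lemma gronwall0 (R : realType) (E dE : R -> R) (K : R) :
  (forall t : R, 0 <= t -> {for t, continuous E}) ->
  (forall t : R, 0 < t -> is_derive t 1 E (dE t)) ->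
  (forall t, 0 < t -> dE t <= K * E t) -> E 0 = 0 ->
  forall t, 0 <= t -> E t <= 0.
Proof.
move=> cE dEP EK E0 t; rewrite le_eqVlt => /predU1P[<-|t0]; first by rewrite E0.
pose G (s : R) := E s * expR (- K * s).
have dG (s : R) : s \in `]0, t[%R -> is_derive s 1 G ((dE s - K * E s) * expR (- K * s)).
  rewrite in_itv/= => /andP[s0 _].
  have := dEP s s0 => dEs.
  by apply: is_derive_eq; rewrite /GRing.scale/=; ring.
have cG : {within `[0, t], continuous G}.
  apply: continuous_in_subspaceT => s; rewrite inE/= in_itv/= => /andP[s0 _].
  apply: (@continuousM R R E (fun s => expR (- K * s))); first exact: cE.
  by apply: continuous_comp; [exact: mulrl_continuous|exact: continuous_expR].
have [s] := MVT t0 dG cG; rewrite in_itv/= => /andP[s0 st].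
rewrite /G E0 mul0r subr0 subr0 => Gt.
rewrite -(pmulr_lle0 _ (expR_gt0 (- K * t))) Gt.
by rewrite pmulr_lle0// pmulr_lle0 ?expR_gt0// subr_le0 EK.
Qed.

Lemma abs_continuousD_lipschitz (R : realType) (f g : R -> R) (a b M : R) :
  abs_continuous_on a b f ->
  (forall x y, a <= x -> x <= y -> y <= b -> `|g y - g x| <= M * (y - x)) ->
  abs_continuous_on a b (fun x => f x + g x).
Proof.
move=> fac gM e e0.
have e20 : 0 < e / 2 by rewrite divr_gt0.
have [d d0 H] := fac _ e20.
have M0 : 0 < `|M| + 1 by rewrite ltr_wpDl.
exists (Num.min d (e / 2 / (`|M| + 1))); first by rewrite lt_min d0 divr_gt0.
move=> n x y xy tI; rewrite lt_min => /andP[sd sM].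
rewrite (le_lt_trans (y := \sum_(i < n) `|f (y i) - f (x i)|
    + \sum_(i < n) (`|M| + 1) * (y i - x i)))//.
  rewrite -big_split/=; apply: ler_sum => i _.
  have [axi [xyi yib]] := xy i.
  have -> : f (y i) + g (y i) - (f (x i) + g (x i)) =
    (f (y i) - f (x i)) + (g (y i) - g (x i)) by ring.
  rewrite (le_trans (ler_normD _ _))// lerD2l (le_trans (gM _ _ _ _ _))//.
  by rewrite ler_wpM2r ?subr_ge0// (le_trans (ler_norm M))// lerDl.
rewrite [ltRHS]splitr ltrD//; first exact: H.
by rewrite -mulr_sumr mulrC -ltr_pdivlMr.
Qed.

Lemma lebesgue_aeS (R : realType) (P Q : R -> Prop) :
  (forall t, P t -> Q t) ->
  {ae (@lebesgue_measure R), forall t : R, P t} ->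
  {ae (@lebesgue_measure R), forall t : R, Q t}.
Proof. by move=> PQ; apply: negligibleS => t; apply: contra_not; exact: PQ. Qed.

Lemma derive_lipschitz (R : realType) (G F : R -> R) (a b : R) : a <= b ->
  (forall t : R, a <= t <= b -> is_derive t 1 G (F t)) ->
  {within `[a, b], continuous F} ->
  exists M, forall x y, a <= x -> x <= y -> y <= b ->
    `|G y - G x| <= M * (y - x).
Proof.
move=> ab dG cF.
have [m _ mF] : exists2 m, m \in `[a, b]%R &
    forall s, s \in `[a, b]%R -> `|F s| <= `|F m|.
  apply: (@EVT_max _ (fun s => `|F s|)) => // s.
  by apply: continuous_comp; [exact: cF|exact: norm_continuous].
exists `|F m| => x y ax xy yb.
have dGxy (z : R) : x <= z -> z <= y -> is_derive z 1 G (F z).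
  by move=> xz zy; apply: dG; rewrite (le_trans ax)// (le_trans zy).
have [z zxy ->] : exists2 z, z \in `[x, y]%R & G y - G x = F z * (y - x).
  apply: MVT_segment => // [z|].
    by rewrite in_itv/= => /andP[/ltW xz /ltW zy]; exact: dGxy.
  apply: continuous_in_subspaceT => z; rewrite inE/= in_itv/= => /andP[xz zy].
  have dGz := dGxy z xz zy.
  by apply/differentiable_continuous/derivable1_diffP.
rewrite normrM (ger0_norm (x := y - x)) ?subr_ge0//.
rewrite ler_wpM2r ?subr_ge0// mF//.
move: zxy; rewrite !in_itv/= => /andP[xz zy].
by rewrite (le_trans ax)//= (le_trans zy).
Qed.

(** If G is a primitive of F, then c - G is absolutely continuous with derivative 0 almost
    everywhere, hence constant. This upgrades the almost-everywhere equation of a weak solution to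
    one valid at every t > 0. *)
Lemma abs_continuous_derive (R : realType) (c F : R -> R) :
  continuous F -> loc_abs_continuous c ->
  {ae (@lebesgue_measure R), forall t : R, 0 < t -> is_derive t 1 c (F t)} ->
  forall t : R, 0 < t -> is_derive t 1 c (F t).
Proof.
move=> cF cac cae; have [G [dG _]] := primitive_ge0 cF.
have cG t : 0 <= t -> c t - G t = c 0 - G 0.
  move=> t0; apply: (@abs_continuous_derive0 _ (fun x => c x - G x)) => //.
    have [||M HM] := @derive_lipschitz _ G F 0 t t0.
    - by move=> s /andP[s0 _]; apply: dG; lra.
    - exact: continuous_subspaceT.
    apply: (@abs_continuousD_lipschitz _ c (fun x => - G x) _ _ M).
      exact: cac.
    by move=> x y x0 xy yt; rewrite -opprD normrN; exact: HM.
  apply: lebesgue_aeS cae => s cs s0.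
  have /dG ? : -1 < s by lra.
  have ? := cs s0.
  by apply: is_derive_eq; rewrite subrr.
move=> t t0.
have /dG dGt : -1 < t by lra.
have : is_derive t 1 (fun s => G s + (c 0 - G 0)) (F t).
  by apply: is_derive_eq; rewrite addr0.
apply: near_eq_is_derive.
near=> s.
have s0 : 0 <= s.
  near: s; apply: filterS (lt_nbhsr t0) => s; exact: ltW.
by rewrite -(cG _ s0) addrC subrK.
Unshelve. all: end_near. Qed.

(** The kernel factors as exp(-delta t) exp(delta s), so eta is exp(-delta t) times a primitive of
    exp(delta s) b(s), and the convolution becomes a first-order equation. *)
Lemma memory_ode (R : realType) (b : R -> R) (delta : R) : continuous b ->
  exists eta : R -> R, [/\ eta 0 = 0,
    forall t : R, 0 <= t -> is_derive t 1 eta (b t - delta * eta t) &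
    forall k t : R, 0 <= t ->
      \int[mu]_(s in `[0, t]) (expR (- delta * (t - s)) * (k * b s)) = k * eta t].
Proof.
move=> cb.
have ceb : continuous (fun s => expR (delta * s) * b s).
  move=> s; apply: (@continuousM R R (fun s => expR (delta * s)) b) (cb s).
  by apply: continuous_comp; [exact: mulrl_continuous|exact: continuous_expR].
have [G [dG GE]] := primitive_ge0 ceb.
pose eta t := expR (- delta * t) * (G t - G 0).
exists eta; split; first by rewrite /eta subrr mulr0.
  move=> t t0; have /dG dGt : -1 < t by lra.
  apply: is_derive_eq; rewrite /eta /GRing.scale/=.
  have e1 : expR (- delta * t) * expR (delta * t) = 1.
    by rewrite -expRD mulNr addNr expR0.
  by rewrite -[X in _ = X - _]mul1r -[X in _ = X * _ - _]e1; ring.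
move=> k t t0; rewrite /eta -GE// mulrA -RintegralZl//; last first.
  apply: continuous_compact_integrable; first exact: segment_compact.
  exact: continuous_subspaceT.
apply: eq_Rintegral => s _; have -> : - delta * (t - s) = - delta * t + delta * s by ring.
by rewrite expRD; ring.
Qed.

Lemma volterra_ode (R : realType) (a b c : R -> R) (k1 k2 k3 k r delta : R) :
  continuous a -> continuous b -> continuous c -> loc_abs_continuous c ->
  {ae (@lebesgue_measure R), forall t : R, 0 < t ->
    exists2 d, is_derive t 1 c d &
      d + k1 * c t + k2 * b t + k3 * a t
      - r * \int[mu]_(s in `[0, t]) (expR (- delta * (t - s)) * (k * b s)) = 0} ->
  exists eta : R -> R, [/\ eta 0 = 0,
    forall t : R, 0 <= t -> is_derive t 1 eta (b t - delta * eta t) &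
    forall t : R, 0 < t ->
      is_derive t 1 c (- (k1 * c t + k2 * b t + k3 * a t - r * k * eta t))].
Proof.
move=> ca cb cc cac cae; have [eta [eta0 deta etaE]] := memory_ode delta cb.
exists eta; split => //.
(* The equation of eta is known only for t >= 0; [Num.max 0 t] makes F continuous on the whole line
   without changing it for t > 0. *)
pose F t := - (k1 * c t + k2 * b t + k3 * a t - r * k * eta (Num.max 0 t)).
have ceM : continuous (fun t : R => eta (Num.max 0 t)).
  move=> t; apply: (@continuous_comp R R R (fun t => Num.max 0 t) eta).
    by apply: continuous_max; [exact: cvg_cst|exact: cvg_id].
  have M0 : 0 <= Num.max 0 t by rewrite le_max lexx.
  have dM := deta _ M0.
  by apply/differentiable_continuous/derivable1_diffP.
have cF : continuous F.
  move=> t; apply: cvgN; apply: cvgB; [apply: cvgD; [apply: cvgD|]|];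
    apply: cvgMr; [exact: cc|exact: cb|exact: ca|exact: ceM].
have dc : forall t : R, 0 < t -> is_derive t 1 c (F t).
  apply: abs_continuous_derive => //.
  apply: lebesgue_aeS cae => t ct t0; have [d dt] := ct t0.
  rewrite etaE ?ltW// => dE.
  apply: is_derive_eq dt _; rewrite /F max_r ?ltW//.
  by apply/eqP; rewrite -subr_eq0 -dE; apply/eqP; ring.
move=> t t0; have := dc t t0; by rewrite /F max_r// ltW.
Qed.

(** * The scalar mode equation: uniqueness and a growing oscillation *)

(** First-order linear system for position a, velocity b, acceleration c and memory variable eta.
    For an eigenvalue l it is used with k2 = beta l, k3 = gamma l and r = rho delta l. *)
Definition third_order_memory (R : realType) (k1 k2 k3 r delta : R)
    (a b c eta : R -> R) (t : R) : Prop :=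
  [/\ is_derive t 1 a (b t), is_derive t 1 b (c t),
      is_derive t 1 c (- (k1 * c t + k2 * b t + k3 * a t - r * eta t)) &
      is_derive t 1 eta (b t - delta * eta t)].

(** The left side is the derivative of x^2 + y^2 + z^2 + w^2 along the system. Each product of two
    unknowns is bounded by the sum of squares; the 3 counts x y, y z and w y, which have coefficient
    1. *)
Lemma third_order_memory_rate (R : realFieldType) (k1 k2 k3 r delta x y z w : R) :
  2 * (x * y + y * z - z * (k1 * z + k2 * y + k3 * x - r * w)
    + w * (y - delta * w)) <=
  2 * (3 + `|k1| + `|k2| + `|k3| + `|r| + `|delta|)
    * (x * x + y * y + z * z + w * w).
Proof.
set S := x * x + y * y + z * z + w * w.
have B (k u v : R) : u * u <= S -> v * v <= S -> 2 * (k * (u * v)) <= 2 * `|k| * S.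
  move=> uS vS; have uv : `|2 * (u * v)| <= 2 * S.
    have := sqr_ge0 (u - v); have := sqr_ge0 (u + v).
    by rewrite ler_norml => *; apply/andP; split; lra.
  rewrite mulrCA (le_trans (ler_norm _))// normrM (mulrC 2 `|k|) -mulrA.
  by rewrite ler_wpM2l.
have [xS yS zS wS] : [/\ x * x <= S, y * y <= S, z * z <= S & w * w <= S].
  by rewrite /S; have := sqr_ge0 x; have := sqr_ge0 y; have := sqr_ge0 z;
    have := sqr_ge0 w; split; lra.
have := B 1 _ _ xS yS; have := B 1 _ _ yS zS; have := B 1 _ _ wS yS; rewrite normr1.
have := B (- k1) _ _ zS zS; have := B (- k2) _ _ zS yS.
have := B (- k3) _ _ zS xS; have := B r _ _ zS wS.
have := B (- delta) _ _ wS wS; rewrite !normrN; clearbody S; lra.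
Qed.

(** By linearity the difference solves the same system; its sum of squares E vanishes at 0 and
    satisfies E' <= K E, so Gronwall applies. *)
Lemma third_order_memory_uniq (R : realType) (k1 k2 k3 r delta : R)
    (a b c eta a' b' c' eta' : R -> R) :
  (forall t : R, 0 <= t -> [/\ {for t, continuous a}, {for t, continuous b},
     {for t, continuous c} & {for t, continuous eta}]) ->
  (forall t : R, 0 <= t -> [/\ {for t, continuous a'}, {for t, continuous b'},
     {for t, continuous c'} & {for t, continuous eta'}]) ->
  (forall t, 0 < t -> third_order_memory k1 k2 k3 r delta a b c eta t) ->
  (forall t, 0 < t -> third_order_memory k1 k2 k3 r delta a' b' c' eta' t) ->
  [/\ a 0 = a' 0, b 0 = b' 0, c 0 = c' 0 & eta 0 = eta' 0] ->
  forall t, 0 <= t -> b t = b' t.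
Proof.
move=> C C' D D' [a0 b0 c0 e0] t t0.
pose x s := a s - a' s; pose y s := b s - b' s.
pose z s := c s - c' s; pose w s := eta s - eta' s.
pose E s := x s * x s + y s * y s + z s * z s + w s * w s.
pose dE s := 2 * (x s * y s + y s * z s
  - z s * (k1 * z s + k2 * y s + k3 * x s - r * w s)
  + w s * (y s - delta * w s)).
pose K := 2 * (3 + `|k1| + `|k2| + `|k3| + `|r| + `|delta|).
have : E t <= 0.
  apply: (@gronwall0 _ E dE K) => // [s s0|s s0|s s0|].
  - have [ca cb cc ce] := C s s0; have [ca' cb' cc' ce'] := C' s s0.
    have cx : {for s, continuous x}  by exact: cvgB.
    have cy : {for s, continuous y}  by exact: cvgB.
    have cz : {for s, continuous z}  by exact: cvgB.
    have cw : {for s, continuous w}  by exact: cvgB.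
    have cM (f : R -> R) : {for s, continuous f} ->
        {for s, continuous (fun u => f u * f u)}.
      by move=> cf; apply: (@continuousM R R f f).
    have cD (f g : R -> R) : {for s, continuous f} -> {for s, continuous g} ->
        {for s, continuous (fun u => f u + g u)}.
      by move=> cf cg; apply: cvgD.
    exact: (cD _ _ (cD _ _ (cD _ _ (cM _ cx) (cM _ cy)) (cM _ cz)) (cM _ cw)).
  - have [ca cb cc ce] := D s s0; have [ca' cb' cc' ce'] := D' s s0.
    have dx : is_derive s 1 x (y s) by exact: is_deriveB.
    have dy : is_derive s 1 y (z s) by exact: is_deriveB.
    have dz : is_derive s 1 z (- (k1 * z s + k2 * y s + k3 * x s - r * w s)).
      by apply: is_derive_eq; rewrite /x /y /z /w; ring.
    have dw : is_derive s 1 w (y s - delta * w s).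
      by apply: is_derive_eq; rewrite /y /w; ring.
    by apply: is_derive_eq; rewrite /dE /GRing.scale/=; ring.
  - exact: third_order_memory_rate.
  - by rewrite /E /x /y /z /w a0 b0 c0 e0 !subrr !mul0r !addr0.
rewrite /E => Et.
have y0 : y t * y t <= 0.
  by apply: le_trans Et; rewrite -!expr2; have := sqr_ge0 (x t);
    have := sqr_ge0 (z t); have := sqr_ge0 (w t); lra.
apply/eqP; rewrite -subr_eq0 -sqrf_eq0; apply/eqP/le_anti.
by rewrite sqr_ge0 andbT expr2.
Qed.

(** The hypotheses say that z = p + i q is a root of (z + delta)(z^3 + k1 z^2 + k2 z + k3) - r z.
    Taking eta = exp(p t) sin(q t) fixes eta(0) = 0 and forces b = eta' + delta eta = exp(p t)(q
    cos(q t) + (p + delta) sin(q t)), whose sine term vanishes at t = 2 pi n / q. *)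
Lemma oscillating_solution (R : realType) (k1 k2 k3 r delta p q : R) :
  0 < p -> 0 < q ->
  p ^+ 4 - 6 * p ^+ 2 * q ^+ 2 + q ^+ 4
    + (k1 + delta) * (p ^+ 3 - 3 * p * q ^+ 2)
    + (k2 + k1 * delta) * (p ^+ 2 - q ^+ 2)
    + (k3 + k2 * delta - r) * p + k3 * delta = 0 ->
  4 * p ^+ 3 * q - 4 * p * q ^+ 3
    + (k1 + delta) * (3 * p ^+ 2 * q - q ^+ 3)
    + (k2 + k1 * delta) * (2 * p * q) + (k3 + k2 * delta - r) * q = 0 ->
  exists a b c eta : R -> R,
    [/\ forall t, third_order_memory k1 k2 k3 r delta a b c eta t,
        eta 0 = 0 &
        forall n : nat, b (2 * pi * n%:R / q) = q * expR (p * (2 * pi * n%:R / q))].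
Proof.
move=> p0 q0.
set re := (X in X = 0) => re0; set im := (X in X = 0) => im0.
pose osc C D (t : R) := expR (p * t) * (C * cos (q * t) + D * sin (q * t)).
have dosc C D (t : R) :
    is_derive t 1 (osc C D) (osc (p * C + q * D) (p * D - q * C) t).
  by apply: is_derive_eq; rewrite /osc /GRing.scale/=; ring.
pose m := p ^+ 2 + q ^+ 2.
have m0 : m != 0 by rewrite gt_eqF// addr_gt0// exprn_gt0.
(* (C, D) encodes Re ((C - i D) exp (z t)) with z = p + i q, so that
   differentiation multiplies C - i D by z; eta has amplitude - i. *)
pose b1 := q; pose b2 := p + delta.
exists (osc ((p * b1 - q * b2) / m) ((q * b1 + p * b2) / m)), (osc b1 b2),
  (osc (p * b1 + q * b2) (p * b2 - q * b1)), (osc 0 1); split.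
- move=> t; split.
  + apply: is_derive_eq (dosc _ _ t) _.
    by rewrite /osc; congr (_ * (_ * _ + _ * _)); rewrite /m; field.
  + exact: dosc.
  + apply: is_derive_eq (dosc _ _ t) _.
    have cE (u v x y : R) : u + x = 0 -> v + y = 0 ->
        expR (p * t) * (u * cos (q * t) + v * sin (q * t)) =
        - (expR (p * t) * (x * cos (q * t) + y * sin (q * t))).
      by move=> /eqP; rewrite addr_eq0 => /eqP-> /eqP;
        rewrite addr_eq0 => /eqP->; ring.
    pose c1 := p * b1 + q * b2; pose c2 := p * b2 - q * b1.
    rewrite [LHS](cE _ _
      (k1 * c1 + k2 * b1 + k3 * ((p * b1 - q * b2) / m))
      (k1 * c2 + k2 * b2 + k3 * ((q * b1 + p * b2) / m) - r)).
    * by rewrite /osc /c1 /c2; ring.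
    (* The residual of the third equation has amplitude -i (re + i im) / z, since a is obtained from
       b by dividing by z; the two goals are its components. *)
    * transitivity ((p * im - q * re) / m); last by rewrite re0 im0; ring.
      by rewrite /re /im /c1 /c2 /b1 /b2 /m; field.
    * transitivity ((p * re + q * im) / m); last by rewrite re0 im0; ring.
      by rewrite /re /im /c1 /c2 /b1 /b2 /m; field.
  + apply: is_derive_eq (dosc _ _ t) _.
    by rewrite /osc /b1 /b2; ring.
- by rewrite /osc !mulr0 sin0 mul0r mulr0 addr0 mulr0.
- move=> n; rewrite /osc.
  have -> : q * (2 * pi * n%:R / q) = 0 + (pi *+ 2) *+ n.
    by rewrite -mulr_natr -(mulr_natr pi); field; rewrite gt_eqF.
  have sin2 : periodic (@sin R) (pi *+ 2).
    by move=> u; rewrite sinD sin2pi cos2pi mulr0 addr0 mulr1.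
  have cos2 : periodic (@cos R) (pi *+ 2).
    by move=> u; rewrite cosD sin2pi cos2pi mulr0 subr0 mulr1.
  by rewrite !periodicn// sin0 cos0 mulr1 mulr0 addr0 mulrC.
Qed.

(** * Inner products, linear operators, and the square root on an eigenvector *)

Lemma dotC (R : realType) (H : lmodType R) (ip : {dot H for (@idfun R)}) (x y : H) :
  ip x y = ip y x.
Proof. by rewrite hermC expr0 mul1r. Qed.

Lemma dotBl (R : realType) (H : lmodType R) (ip : {dot H for (@idfun R)}) (x y z : H) :
  ip (x - y) z = ip x z - ip y z.
Proof. exact: linearBl. Qed.

Lemma dotZl (R : realType) (H : lmodType R) (ip : {dot H for (@idfun R)}) (a : R) (x y : H) :
  ip (a *: x) y = a * ip x y.
Proof. exact: linearZl_LR. Qed.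

Lemma dotZr (R : realType) (H : lmodType R) (ip : {dot H for (@idfun R)}) (a : R) (x y : H) :
  ip x (a *: y) = a * ip x y.
Proof. by rewrite dotC dotZl dotC. Qed.

Lemma dot_cauchy_schwarz (R : realType) (H : normedModType R)
    (ip : {dot H for (@idfun R)}) : norm_induced_by ip ->
  forall x y : H, (ip x y) ^+ 2 <= `|x| ^+ 2 * `|y| ^+ 2.
Proof.
move=> nip x y.
have [->|y0] := eqVneq y 0; first by rewrite linear0r expr0n/= mulr_ge0// sqr_ge0.
have n0 : 0 < `|y| ^+ 2 by rewrite exprn_gt0// normr_gt0.
have : 0 <= ip (`|y| ^+ 2 *: x - ip x y *: y) (`|y| ^+ 2 *: x - ip x y *: y).
  by rewrite -nip sqr_ge0.
rewrite dotBl !(dotC ip _ (_ - _)) !dotBl !dotZl !dotZr (dotC ip y x) -!nip.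
move=> h; rewrite -subr_ge0 -(pmulr_rge0 _ n0); apply: le_trans h _.
rewrite le_eqVlt; apply/orP; left; apply/eqP; ring.
Qed.

Lemma dot_norm_le (R : realType) (H : normedModType R)
    (ip : {dot H for (@idfun R)}) : norm_induced_by ip ->
  forall x y : H, `|ip x y| <= `|x| * `|y|.
Proof.
move=> nip x y; rewrite -ler_sqr ?nnegrE ?mulr_ge0//.
by rewrite real_normK ?num_real// exprMn dot_cauchy_schwarz.
Qed.

Lemma linop0 (R : realType) (H : lmodType R) (S : linop H) : S 0 = 0.
Proof.
have := op_lin 1 (dom0 S) (dom0 S); rewrite !scale1r addr0 => /eqP.
by rewrite -subr_eq0 opprD addrA subrr sub0r oppr_eq0 => /eqP.
Qed.

Lemma linop_domZ (R : realType) (H : lmodType R) (S : linop H) (a : R) (x : H) :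
  dom S x -> dom S (a *: x).
Proof. by move=> Sx; rewrite -[_ *: _]addr0; apply: dom_lin => //; exact: dom0. Qed.

Lemma linopZ (R : realType) (H : lmodType R) (S : linop H) (a : R) (x : H) :
  dom S x -> S (a *: x) = a *: S x.
Proof.
move=> Sx; rewrite -[in LHS](addr0 (_ *: _)) op_lin//; last exact: dom0.
by rewrite linop0 addr0.
Qed.

Lemma linop_domB (R : realType) (H : lmodType R) (S : linop H) (x y : H) :
  dom S x -> dom S y -> dom S (x - y).
Proof. by move=> Sx Sy; rewrite addrC -scaleN1r; exact: dom_lin. Qed.

Lemma linopB (R : realType) (H : lmodType R) (S : linop H) (x y : H) :
  dom S x -> dom S y -> S (x - y) = S x - S y.
Proof. by move=> Sx Sy; rewrite addrC -scaleN1r op_lin// scaleN1r addrC. Qed.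

Lemma selfadjoint_sym (R : realType) (H : normedModType R)
    (ip : {dot H for (@idfun R)}) (S : linop H) (x y : H) :
  selfadjoint ip S -> dom S x -> dom S y -> ip (S x) y = ip x (S y).
Proof. by move=> [_ /(_ y (S y)) [_ h]] Sx Sy; exact: (h (conj Sy erefl)). Qed.

(* The component f = S e - sqrt l *: e satisfies S f = - sqrt l *: f, which
   contradicts S >= 0 unless f = 0. *)
Lemma sqrt_op_eigen (R : realType) (H : normedModType R)
    (ip : {dot H for (@idfun R)}) (A S : linop H) (l : R) (e : H) :
  norm_induced_by ip -> is_sqrt_op ip A S -> 0 < l -> dom A e -> A e = l *: e ->
  dom S e /\ S e = Num.sqrt l *: e.
Proof.
move=> nip [_ S0 dS AS] l0 Ae Ael.
have [Se SSe] := (dS e).1 Ae; split => //.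
have r0 : 0 < Num.sqrt l by rewrite sqrtr_gt0.
pose f := S e - Num.sqrt l *: e.
have Sf : dom S f by apply: linop_domB => //; exact: linop_domZ.
have SfE : S f = - Num.sqrt l *: f.
  rewrite linopB//; last exact: linop_domZ.
  rewrite linopZ// -(AS e Ae) Ael /f scalerBr scalerA mulNr -expr2 sqr_sqrtr ?ltW//.
  by rewrite !scaleNr opprK addrC.
have := S0 f Sf; rewrite SfE dotZl -nip mulNr oppr_ge0.
rewrite pmulr_rle0// => f0; apply/eqP; rewrite -subr_eq0 -normr_eq0 -sqrf_eq0.
by rewrite eq_le f0 sqr_ge0.
Qed.

(** * Limits on the half-line and pairing with a fixed vector *)

Lemma within_cvg0P (R : realType) (A : set R) (t : R) (g : R -> R) :
  (g s @[s --> within A (nbhs t)] --> (0 : R)) <->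
  forall e, 0 < e -> exists2 h, 0 < h &
    forall s, `|s - t| < h -> A s -> `|g s| <= e.
Proof.
split=> [/cvgrPdist_le gA e e0|H].
  have := gA e e0; rewrite near_withinE => /nbhs_ballP[h /= h0 hA].
  exists h => // s st As; have := hA s; rewrite /ball/= distrC => /(_ st As).
  by rewrite sub0r normrN.
apply/cvgrPdist_le => e /H[h h0 hA]; rewrite near_withinE; apply/nbhs_ballP.
exists h => //= s; rewrite /ball/= distrC => st As.
by rewrite sub0r normrN; exact: hA.
Qed.

Lemma within_dnbhs_cvg0P (R : realType) (A : set R) (t : R) (g : R -> R) :
  (g s @[s --> within A t^'] --> (0 : R)) <->
  forall e, 0 < e -> exists2 h, 0 < h &
    forall s, `|s - t| < h -> s != t -> A s -> `|g s| <= e.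
Proof.
split=> [/cvgrPdist_le gA e e0|H].
  have := gA e e0; rewrite near_withinE near_withinE => /nbhs_ballP[h /= h0 hA].
  exists h => // s st snt As; have := hA s; rewrite /ball/= distrC => /(_ st snt As).
  by rewrite sub0r normrN.
apply/cvgrPdist_le => e /H[h h0 hA].
rewrite near_withinE near_withinE; apply/nbhs_ballP.
exists h => //= s; rewrite /ball/= distrC => st snt As.
by rewrite sub0r normrN; exact: hA.
Qed.

(* Only times t >= 0 matter: composing with max 0 gives two-sided continuity. *)
Lemma continuous_max0 (R : realType) (f : R -> R) (N : R -> R -> R) (M : R) :
  (forall t, 0 <= t -> N s t @[s --> within `[0, +oo[ (nbhs t)] --> (0 : R)) ->
  (forall s t, 0 <= s -> 0 <= t -> `|f s - f t| <= M * N s t) ->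
  continuous (fun t : R => f (Num.max 0 t)).
Proof.
move=> N0 fN t; apply/cvgrPdist_le => e e0.
have t0 : 0 <= Num.max 0 t by rewrite le_max lexx.
have M0 : 0 < `|M| + 1 by rewrite ltr_wpDl.
have [|h h0 H] := (within_cvg0P _ _ _).1 (N0 _ t0) (e / (`|M| + 1)).
  by rewrite divr_gt0.
apply/nbhs_ballP; exists h => //= s; rewrite /ball/= distrC => st.
have s0 : 0 <= Num.max 0 s by rewrite le_max lexx.
rewrite distrC (le_trans (fN _ _ s0 t0))// (le_trans (ler_norm _))// normrM.
have /H : `|Num.max 0 s - Num.max 0 t| < h.
  apply: le_lt_trans st; have := ler_norm (s - t); have := ler_norm (t - s).
  rewrite (distrC t s) ler_norml.
  by case: (leP 0 s); case: (leP 0 t) => *; apply/andP; split; lra.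
rewrite /= in_itv/= s0 => /(_ isT) Ns.
rewrite (le_trans (ler_pM _ _ _ Ns) (y := (`|M| + 1) * (e / (`|M| + 1))))//.
  by rewrite lerDl.
by rewrite mulrC divfK// gt_eqF.
Qed.

(** A functional bounded by N carries derivatives in N to scalar derivatives. The set D allows for a
    bound that holds only on [dom S], as for [norm1]. *)
Lemma deriv_on_halfline_dot (R : realType) (H : normedModType R)
    (ip : {dot H for (@idfun R)}) (N : H -> R) (D : set H) (M : R) (e : H)
    (u v : R -> H) :
  deriv_on_halfline N u v ->
  (forall x, D x -> `|ip x e| <= M * N x) ->
  (forall (k s t : R), 0 <= s -> 0 <= t -> D (k *: (u s - u t) - v t)) ->
  forall t : R, 0 < t ->
    is_derive t 1 (fun s : R => ip (u (Num.max 0 s)) e) (ip (v t) e).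
Proof.
move=> duv eN uvD t t0; apply/is_derive1P => eps eps0.
have M0 : 0 < `|M| + 1 by rewrite ltr_wpDl.
have [|h h0 hH] := (within_dnbhs_cvg0P _ _ _).1 (duv t (ltW t0)) (eps / (`|M| + 1)).
  by rewrite divr_gt0.
(* Staying within distance t of t keeps s positive, so that [Num.max 0 s] is s. *)
exists (Num.min h t); first by rewrite lt_min h0.
move=> s; rewrite lt_min => /andP[sh st].
have s0 : 0 < s by move: st; rewrite ltr_norml => /andP[]; lra.
rewrite (max_r (ltW s0)) (max_r (ltW t0)).
have [->|snt] := eqVneq s t; first by rewrite !subrr mulr0 subr0 normr0 mulr0.
have st0 : s - t != 0 by rewrite subr_eq0.
set x := (s - t)^-1 *: (u s - u t) - v t.
have -> : ip (u s) e - ip (u t) e - ip (v t) e * (s - t) = (s - t) * ip x e.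
  by rewrite /x dotBl dotZl dotBl; field.
rewrite normrM mulrC ler_wpM2r// (le_trans (eN x _))//.
  by apply: uvD; exact: ltW.
have := hH s sh snt; rewrite /= in_itv/= (ltW s0) => /(_ isT) Nx.
rewrite (le_trans (ler_norm _))// normrM.
rewrite (le_trans (ler_pM _ _ _ Nx) (y := (`|M| + 1) * (eps / (`|M| + 1))))//.
  by rewrite lerDl.
by rewrite mulrC divfK// gt_eqF.
Qed.

(** * Passage between weak solutions and scalar modes *)

Lemma ip1_eigen (R : realType) (H : normedModType R) (ip : {dot H for (@idfun R)})
    (S : linop H) (l : R) (e x : H) :
  selfadjoint ip S -> 0 <= l -> dom S e -> S e = Num.sqrt l *: e -> dom S x ->
  ip1 ip S x e = l * ip x e.
Proof.
move=> sS l0 Se SeE Sx.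
by rewrite /ip1 SeE dotZr (selfadjoint_sym sS Sx Se) SeE dotZr mulrA -expr2 sqr_sqrtr.
Qed.

Lemma phase_norm_ge (R : realType) (H : normedModType R) (S : linop H) (x : H * H * H) :
  [/\ norm1 S x.1.1 <= phase_norm S x, norm1 S x.1.2 <= phase_norm S x &
      `|x.2| <= phase_norm S x].
Proof.
have h1 := sqr_ge0 (norm1 S x.1.1); have h2 := sqr_ge0 (norm1 S x.1.2).
have h3 := sqr_ge0 `|x.2|.
have le_sqrt (y z : R) : 0 <= y -> y ^+ 2 <= z -> y <= Num.sqrt z.
  by move=> y0 yz; rewrite -(ger0_norm y0) -sqrtr_sqr ler_wsqrtr.
by split; apply: le_sqrt; rewrite ?normr_ge0//; lra.
Qed.

Lemma weak_solution_mode (R : realType) (H : normedModType R)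
    (ip : {dot H for (@idfun R)}) (S : linop H)
    (alpha beta gamma rho delta l : R) (U0 : H * H * H) (U : R -> H * H * H) (e : H) :
  norm_induced_by ip -> selfadjoint ip S -> 0 < l -> dom S e ->
  S e = Num.sqrt l *: e ->
  weak_solution ip S alpha beta gamma rho delta U0 U ->
  let a t := ip (U (Num.max 0 t)).1.1 e in
  let b t := ip (U (Num.max 0 t)).1.2 e in
  let c t := ip (U (Num.max 0 t)).2 e in
  exists eta : R -> R, [/\ eta 0 = 0,
    forall t : R, 0 <= t -> [/\ {for t, continuous a}, {for t, continuous b},
      {for t, continuous c} & {for t, continuous eta}] &
    forall t : R, 0 < t -> third_order_memory alpha (beta * l) (gamma * l)
      (rho * delta * l) delta a b c eta t].
Proof.
move=> nip sS l0 Se SeE [[phU cU] du dv _ eqU] a b c.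
have hS x : dom S x -> ip1 ip S x e = l * ip x e.
  by move=> Sx; apply: ip1_eigen => //; exact: ltW.
(* Position and velocity are controlled only in [norm1]; the eigenvector relation turns the pairing
   with e in H into one in H^1, which [norm1] bounds. *)
have bnd1 x : dom S x -> `|ip x e| <= l^-1 * `|S e| * norm1 S x.
  move=> Sx; have -> : ip x e = l^-1 * ip1 ip S x e.
    by rewrite hS// mulKf// gt_eqF.
  rewrite normrM gtr0_norm ?invr_gt0// -mulrA ler_wpM2l ?invr_ge0 ?(ltW l0)// [leRHS]mulrC.
  exact: dot_norm_le.
have bnd0 (x : H) : `|ip x e| <= `|e| * `|x| by rewrite [leRHS]mulrC dot_norm_le.
have M10 : 0 <= l^-1 * `|S e| by rewrite mulr_ge0// invr_ge0 ltW.
have ca : continuous a.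
  apply: (@continuous_max0 _ (fun t => ip (U t).1.1 e)
    (fun s t => phase_norm S (U s - U t)) (l^-1 * `|S e|) cU) => s t s0 t0.
  have [sU _ _] := phase_norm_ge S (U s - U t).
  rewrite -dotBl (le_trans (bnd1 _ _)) ?ler_wpM2l//.
  by apply: linop_domB; [have [] := phU s s0|have [] := phU t t0].
have cb : continuous b.
  apply: (@continuous_max0 _ (fun t => ip (U t).1.2 e)
    (fun s t => phase_norm S (U s - U t)) (l^-1 * `|S e|) cU) => s t s0 t0.
  have [_ sU _] := phase_norm_ge S (U s - U t).
  rewrite -dotBl (le_trans (bnd1 _ _)) ?ler_wpM2l//.
  by apply: linop_domB; [have [] := phU s s0|have [] := phU t t0].
have cc : continuous c.
  apply: (@continuous_max0 _ (fun t => ip (U t).2 e)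
    (fun s t => phase_norm S (U s - U t)) `|e| cU) => s t s0 t0.
  have [_ _ sU] := phase_norm_ge S (U s - U t).
  by rewrite -dotBl (le_trans (bnd0 _)) ?ler_wpM2l.
have da (t : R) : 0 < t -> is_derive t 1 a (b t).
  move=> t0; rewrite /b max_r ?ltW//.
  apply: (deriv_on_halfline_dot (D := dom S) du bnd1) t0 => k s r s0 r0.
  have [us _] := phU s s0; have [ur vr] := phU r r0.
  apply: linop_domB => //; apply: linop_domZ; exact: linop_domB.
have db (t : R) : 0 < t -> is_derive t 1 b (c t).
  move=> t0; rewrite /c max_r ?ltW//.
  by apply: (deriv_on_halfline_dot (D := setT) dv _) t0.
have [cac cae] := eqU e Se.
have {}cac : loc_abs_continuous c.
  move=> T T0 eps eps0; have [d d0 Hd] := cac T T0 eps eps0.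
  exists d => // n x y xy tI sd; have := Hd n x y xy tI sd.
  congr (_ < _); apply: eq_bigr => i _; have [xi [xyi _]] := xy i.
  by rewrite /c !max_r// (le_trans xi).
have [|eta [eta0 deta dc]] := @volterra_ode R a b c alpha (beta * l) (gamma * l)
  l (rho * delta) delta ca cb cc cac.
  apply: lebesgue_aeS cae => t et t0; have [d dc dE] := et (ltW t0).
  have [ut vt] := phU t (ltW t0).
  exists d.
    apply: near_eq_is_derive dc; near=> s.
    rewrite /c max_r//.
    by near: s; apply: filterS (lt_nbhsr t0) => s; exact: ltW.
  rewrite /a /b /c max_r ?ltW// -[RHS]dE !hS// !mulrA.
  congr (_ - _ * _); apply: eq_Rintegral => s; rewrite inE/= in_itv/= => /andP[s0 _].
  by rewrite max_r// hS//; have [] := phU s s0.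
exists eta; split; [exact: eta0|move=> t t0|move=> t t0]; split.
- exact: ca.
- exact: cb.
- exact: cc.
- have det := deta t t0.
  by apply/differentiable_continuous/derivable1_diffP.
- exact: da.
- exact: db.
- exact: dc.
- exact/deta/ltW.
Unshelve. all: end_near. Qed.

Lemma deriv_on_halfline_scale (R : realType) (H : normedModType R) (N : H -> R)
    (a b : R -> R) (e : H) :
  (forall k, N (k *: e) = `|k| * N e) -> (forall t : R, is_derive t 1 a (b t)) ->
  deriv_on_halfline N (fun t => a t *: e) (fun t => b t *: e).
Proof.
move=> NZ da t t0; apply/within_dnbhs_cvg0P => eps eps0.
have M0 : 0 < `|N e| + 1 by rewrite ltr_wpDl.
have [|h h0 hH] := (is_derive1P _ _ _).1 (da t) (eps / (`|N e| + 1)).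
  by rewrite divr_gt0.
exists h => // s sh snt _.
have st0 : s - t != 0 by rewrite subr_eq0.
rewrite -scalerBl scalerA -scalerBl NZ !normrM normr_id.
have -> : (s - t)^-1 * (a s - a t) - b t = (a s - a t - b t * (s - t)) / (s - t).
  by field.
rewrite normf_div (@le_trans _ _ (eps / (`|N e| + 1) * (`|N e| + 1)))//.
  apply: ler_pM; rewrite ?divr_ge0 ?lerDl//.
  by rewrite ler_pdivrMr ?normr_gt0// hH.
by rewrite divfK// gt_eqF.
Qed.

(** Tested against any phi, the equation along e is the scalar one multiplied by the number
    [ip e phi], because [ip1 ip S e phi] is l times it. *)
Lemma mode_weak_solution (R : realType) (H : normedModType R)
    (ip : {dot H for (@idfun R)}) (S : linop H)
    (alpha beta gamma rho delta l : R) (a b c eta : R -> R) (e : H) :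
  norm_induced_by ip -> selfadjoint ip S -> 0 < l -> 0 < delta -> dom S e ->
  S e = Num.sqrt l *: e ->
  (forall t, third_order_memory alpha (beta * l) (gamma * l)
      (rho * delta * l) delta a b c eta t) -> eta 0 = 0 ->
  weak_solution ip S alpha beta gamma rho delta
    (a 0 *: e, b 0 *: e, c 0 *: e) (fun t => (a t *: e, b t *: e, c t *: e)).
Proof.
move=> nip sS l0 delta0 Se SeE D eta0.
have dcont (f f' : R -> R) : (forall t : R, is_derive t 1 f (f' t)) -> continuous f.
  by move=> df t; have ? := df t; apply/differentiable_continuous/derivable1_diffP.
have da (t : R) : is_derive t 1 a (b t) by have [] := D t.
have db (t : R) : is_derive t 1 b (c t) by have [] := D t.
pose c' t := - (alpha * c t + beta * l * b t + gamma * l * a t - rho * delta * l * eta t).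
have dc (t : R) : is_derive t 1 c (c' t) by have [] := D t.
have de (t : R) : is_derive t 1 eta (b t - delta * eta t) by have [] := D t.
have ca := dcont _ _ da; have cb := dcont _ _ db.
have cc := dcont _ _ dc; have ce := dcont _ _ de.
have cc' : continuous c'.
  move=> t; apply: cvgN; apply: cvgB; [apply: cvgD; [apply: cvgD|]|];
    apply: cvgMr; [exact: cc|exact: cb|exact: ca|exact: ce].
have norm1Z k : norm1 S (k *: e) = `|k| * norm1 S e.
  by rewrite /norm1 linopZ// normrZ.
split => //.
- split => [t _|t t0]; first by split; exact: linop_domZ.
  apply: cvg_within_filter.
  rewrite (_ : (fun s => _) = (fun s => Num.sqrt (
      (a s - a t) ^+ 2 * norm1 S e ^+ 2 + (b s - b t) ^+ 2 * norm1 S e ^+ 2 +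
      (c s - c t) ^+ 2 * `|e| ^+ 2))).
    pose g (s : R) := (a s - a t) ^+ 2 * norm1 S e ^+ 2 +
      (b s - b t) ^+ 2 * norm1 S e ^+ 2 + (c s - c t) ^+ 2 * `|e| ^+ 2.
    have g0 : Num.sqrt (g t) = 0.
      by rewrite /g !subrr expr0n/= !mul0r !addr0 sqrtr0.
    have sqc (f : R -> R) (k : R) : continuous f ->
        (f s - f t) ^+ 2 * k @[s --> t] --> (f t - f t) ^+ 2 * k.
      move=> cf; apply: cvgMl; apply: (@continuous_comp R R R (fun s => f s - f t) (fun x => x ^+ 2)).
        by apply: cvgB; [exact: cf|exact: cvg_cst].
      exact: exprn_continuous.
    suff : Num.sqrt (g s) @[s --> t] --> Num.sqrt (g t) by rewrite g0.
    apply: (@continuous_comp R R R g Num.sqrt).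
      by apply: cvgD; [apply: cvgD|]; exact: sqc.
    exact: sqrt_continuous.
  apply/funext => s; rewrite /phase_norm/= -!scalerBl !norm1Z normrZ !exprMn.
  by rewrite !real_normK ?num_real.
- exact: deriv_on_halfline_scale.
- by apply: deriv_on_halfline_scale => // k; rewrite normrZ.
- move=> phi Sphi.
  have ip1E k : ip1 ip S (k *: e) phi = l * ip e phi * k.
    rewrite /ip1 linopZ// dotZl dotC -/(ip1 ip S phi e) (ip1_eigen sS (ltW l0) Se SeE Sphi).
    by rewrite dotC mulrC.
  have dcp (t : R) : is_derive t 1 (fun r => ip (c r *: e) phi) (c' t * ip e phi).
    have ? := dc t; rewrite (_ : (fun r => _) = (fun r => c r * ip e phi)).
      by apply: is_derive_eq; rewrite /GRing.scale/= mulr0 add0r mulrC.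
    by apply/funext => r; rewrite dotZl.
  split.
    move=> T T0.
    have [|M HM] := @derive_lipschitz _ (fun r => ip (c r *: e) phi)
      (fun t => c' t * ip e phi) 0 T T0.
      by apply: continuous_subspaceT => t; apply: cvgMl; exact: cc'.
    (* Adding the zero function lets the Lipschitz perturbation lemma yield absolute continuity of a
       Lipschitz function. *)
    rewrite (_ : (fun t => _) = (fun t => 0 + ip (c t *: e) phi)); last first.
      by apply/funext => t; rewrite add0r.
    apply: (@abs_continuousD_lipschitz _ (fun=> 0) _ _ _ M) => //.
    move=> eps eps0; exists 1 => // n x y _ _ _.
    by rewrite big1// => i _; rewrite subrr normr0.
  apply: aeW => t t0; exists (c' t * ip e phi); first exact: dcp.
  have [zeta [zeta0 dz zE]] := memory_ode delta cb.
  (* The given eta is identified with the memory integral: both solve the same first-order equation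
     from 0, and the square of their difference is nonincreasing as delta > 0. *)
  have zeta_eta : zeta t = eta t.
    pose w s := zeta s - eta s.
    have dw (s : R) : 0 <= s -> is_derive s 1 w (- delta * w s).
      move=> s0; have ? := de s; have ? := dz s s0.
      by apply: is_derive_eq; rewrite /w; ring.
    have : w t * w t <= 0.
      apply: (@gronwall0 _ (fun s => w s * w s) (fun s => - delta * (w s * w s) * 2) 0) => //.
      + move=> s s0; have ? := dw s s0.
        by apply/differentiable_continuous/derivable1_diffP.
      + move=> s s0; have ? := dw s (ltW s0).
        by apply: is_derive_eq; rewrite /GRing.scale/=; ring.
      + by move=> s s0; have := mulr_ge0 (ltW delta0) (sqr_ge0 (w s)); lra.
      + by rewrite /w zeta0 eta0 subrr mul0r.
    move=> w0; apply/eqP; rewrite -subr_eq0 -sqrf_eq0 -/(w t) expr2.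
    by rewrite eq_le w0 -expr2 sqr_ge0.
  under eq_Rintegral do rewrite /= ip1E.
  rewrite zE// zeta_eta /= !ip1E dotZl /c'; ring.
Qed.

Theorem theorem4p1 (R : realType) (alpha beta gamma rho lambda : R)
  (alpha_gt0 : 0 < alpha) (beta_gt0 : 0 < beta) (gamma_gt0 : 0 < gamma)
  (gamma_le : gamma <= alpha * beta)
  (rho_gt : beta - gamma / alpha < rho) (rho_lt : rho < beta)
  (lambda_gt0 : 0 < lambda) :
  exists2 delta0 : R, 0 < delta0 &
  forall (H : completeNormedModType R) (ip : {dot H for (@idfun R)})
    (A sqrtA : linop H),
    norm_induced_by ip -> separable H ->
    selfadjoint ip A -> strictly_positive A -> is_sqrt_op ip A sqrtA ->
    eigenvalue_of A lambda ->
  forall delta : R, delta0 < delta ->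
  exists (eps : R) (U0 : H * H * H) (tn : nat -> R),
    [/\ 0 < eps, phase sqrtA U0, forall n, 0 <= tn n,
        tn n @[n --> \oo] --> +oo &
        (exists U : R -> H * H * H,
           weak_solution ip sqrtA alpha beta gamma rho delta U0 U) /\
        (forall U : R -> H * H * H,
           weak_solution ip sqrtA alpha beta gamma rho delta U0 U ->
           forall n, lambda * expR (eps * tn n)
                     <= energy sqrtA rho delta U (tn n))].
Proof.
(* Positivity of kappa is the condition rho > beta - gamma / alpha; kappa times lambda is the
   leading coefficient in delta of the instability quantity A D - B C. *)
pose kappa := gamma - alpha * (beta - rho).
have kappa0 : 0 < kappa.
  rewrite subr_gt0 mulrC -ltr_pdivlMr//; lra.
have rho0 : 0 <= rho.
  apply: ltW; apply: le_lt_trans rho_gt.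
  by rewrite subr_ge0 ler_pdivrMr// mulrC.
have nu0 : 0 < beta - rho by rewrite subr_gt0.
have K0 : 0 < beta * lambda * (gamma + (beta - rho)) / kappa.
  apply: divr_gt0 => //; apply: mulr_gt0; first exact: mulr_gt0.
  exact: addr_gt0.
(* A D - B C splits into two terms: the quotient makes the one with factor kappa delta - beta lambda
   (gamma + beta - rho) positive, the summand 1 the one with factor delta - 1. *)
exists (1 + beta * lambda * (gamma + (beta - rho)) / kappa).
  by rewrite addr_gt0.
move=> H ip A S nip _ _ _ sqS [e0 [Ae0 e0n0 Ae0E]] delta deltaP.
have delta1 : 1 < delta.
  by apply: le_lt_trans deltaP; rewrite lerDl ltW.
have delta0 : 0 < delta by lra.
have big : beta * lambda * (gamma + (beta - rho)) < kappa * delta.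
  by rewrite [ltRHS]mulrC -ltr_pdivrMr//; lra.
have [p [q [p0 q0 re im]]] : exists p q : R, [/\ 0 < p, 0 < q,
    p ^+ 4 - 6 * p ^+ 2 * q ^+ 2 + q ^+ 4
      + (alpha + delta) * (p ^+ 3 - 3 * p * q ^+ 2)
      + (beta * lambda + alpha * delta) * (p ^+ 2 - q ^+ 2)
      + (gamma * lambda + beta * lambda * delta - rho * delta * lambda) * p
      + gamma * lambda * delta = 0 &
    4 * p ^+ 3 * q - 4 * p * q ^+ 3
      + (alpha + delta) * (3 * p ^+ 2 * q - q ^+ 3)
      + (beta * lambda + alpha * delta) * (2 * p * q)
      + (gamma * lambda + beta * lambda * delta - rho * delta * lambda) * q = 0].
  have CE : gamma * lambda + beta * lambda * delta - rho * delta * lambda =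
      lambda * (gamma + (beta - rho) * delta) by ring.
  apply: unstable_quartic.
  - by rewrite addr_gt0.
  - by rewrite addr_gt0// mulr_gt0.
  - by rewrite CE mulr_gt0// addr_gt0// mulr_gt0.
  - by rewrite !mulr_gt0.
  - rewrite -subr_gt0 CE.
    have -> : (alpha + delta) * (gamma * lambda * delta) -
      (beta * lambda + alpha * delta) * (lambda * (gamma + (beta - rho) * delta)) =
      lambda * (delta * (kappa * delta - beta * lambda * (gamma + (beta - rho)))
        + (delta - 1) * (beta * lambda * gamma)) by rewrite /kappa; ring.
    by rewrite mulr_gt0// addr_gt0// mulr_gt0// ?subr_gt0// !mulr_gt0.
  - rewrite -subr_ge0.
    have -> : (alpha + delta) * (beta * lambda + alpha * delta) -
      (gamma * lambda + beta * lambda * delta - rho * delta * lambda) =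
      lambda * (alpha * beta - gamma) + alpha * delta * (alpha + delta)
        + rho * delta * lambda by ring.
    by rewrite !addr_ge0// !mulr_ge0// ?subr_ge0// ?addr_ge0// ltW.
have [a [b [c [eta [D eta0 bE]]]]] := oscillating_solution p0 q0 re im.
have [Se0 Se0E] := sqrt_op_eigen nip sqS lambda_gt0 Ae0 Ae0E.
have sS : selfadjoint ip S by case: sqS.
have eigZ k : dom S (k *: e0) /\ S (k *: e0) = Num.sqrt lambda *: (k *: e0).
  split; first exact: linop_domZ.
  by rewrite linopZ// Se0E !scalerA mulrC.
(* The datum direction e gets norm 1 / q and the test vector f = q^2 e norm q, so that [ip e f] is 1
   and pairing with f recovers the scalar mode exactly. *)
pose k := (q * `|e0|)^-1.
have k0 : 0 < k by rewrite invr_gt0 mulr_gt0// normr_gt0.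
have kE : k * `|e0| * q = 1.
  by rewrite /k; field; rewrite normr_eq0 e0n0 gt_eqF.
have [Se SeE] := eigZ k; set e := k *: e0 in Se SeE.
have [Sf SfE] := eigZ (q ^+ 2 * k); set f := _ *: e0 in Sf SfE.
have ef : ip e f = 1.
  rewrite /e /f dotZl dotZr -nip.
  have -> : k * (q ^+ 2 * k * `|e0| ^+ 2) = (k * `|e0| * q) ^+ 2 by ring.
  by rewrite kE expr1n.
have nf : `|f| = q.
  rewrite /f normrZ gtr0_norm ?mulr_gt0 ?exprn_gt0//.
  have -> : q ^+ 2 * k * `|e0| = (k * `|e0| * q) * q by ring.
  by rewrite kE mul1r.
pose tn (n : nat) : R := 2 * pi * n%:R / q.
have tn0 n : 0 <= tn n by rewrite divr_ge0 ?(ltW q0)// !mulr_ge0 ?pi_ge0.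
exists (2 * p), (a 0 *: e, b 0 *: e, c 0 *: e), tn; split => //.
- by rewrite mulr_gt0.
- by split; exact: linop_domZ.
- apply/cvgryPge => M; near=> n.
  rewrite /tn ler_pdivlMr// -ler_pdivrMl ?mulr_gt0 ?pi_gt0//.
  by near: n; exact: nbhs_infty_ger.
split.
  exists (fun t => (a t *: e, b t *: e, c t *: e)).
  exact: (mode_weak_solution nip sS lambda_gt0 delta0 Se SeE D eta0).
move=> U wU n.
have [zeta [zeta0 cU DU]] := weak_solution_mode nip sS lambda_gt0 Sf SfE wU.
have [[phU _] _ _ U0E _] := wU.
have bU : ip (U (tn n)).1.2 f = b (tn n).
  rewrite -[in LHS](max_r (tn0 n)).
  apply: (third_order_memory_uniq cU _ DU (fun t _ => D t)) => //.
    move=> t _; have [? ? ? ?] := D t.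
    by split; apply/differentiable_continuous/derivable1_diffP.
  by rewrite maxxx U0E/= zeta0 eta0; split; rewrite // dotZl ef mulr1.
have [Su Sv] := phU _ (tn0 n).
have : lambda * expR (2 * p * tn n) <= norm1 S (U (tn n)).1.2 ^+ 2.
  (* Cauchy-Schwarz in H^1 reads (lambda b)^2 <= |v|_1^2 lambda q^2; with b = q exp(p t) the factors
     q cancel and exactly lambda remains in the bound. *)
  have := dot_cauchy_schwarz nip (S (U (tn n)).1.2) (S f).
  rewrite -/(ip1 ip S (U (tn n)).1.2 f) (ip1_eigen sS (ltW lambda_gt0) Sf SfE Sv).
  rewrite bU bE -/(tn n) SfE normrZ nf ger0_norm ?sqrtr_ge0// !exprMn.
  rewrite sqr_sqrtr ?(ltW lambda_gt0)// -/(norm1 S _) => CS.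
  have -> : 2 * p * tn n = p * tn n + p * tn n by ring.
  rewrite expRD -(ler_pM2r (_ : 0 < lambda * q ^+ 2)) ?mulr_gt0 ?exprn_gt0//.
  by apply: le_trans CS; rewrite le_eqVlt; apply/orP; left; apply/eqP; ring.
move=> h; apply: le_trans h _; rewrite /energy.
have h1 := sqr_ge0 (norm1 S (U (tn n)).1.1); have h2 := sqr_ge0 `|(U (tn n)).2|.
have : 0 <= rho * delta *
    (\int[lebesgue_measure]_(s in `[0, tn n]) (expR (- delta * (tn n - s)) *
      norm1 S ((U (tn n)).1.2 - (U s).1.2) ^+ 2)).
  apply: mulr_ge0; first by rewrite mulr_ge0// ltW.
  apply: Rintegral_ge0 => s _.
  by rewrite mulr_ge0 ?expR_ge0// sqr_ge0.
lra.
Unshelve. all: end_near. Qed.
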